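(* Let $X=X^\top\in\mathbb{R}^{n\times n}$ be a solution of CGCARE($\Sigma$), and let $$\mathcal{R}_{0,X}=\operatorname{im}\,[\,BG\;\;A_XBG\;\;A_X^2BG\;\;\cdots\;\;A_X^{n-1}BG\,].$$ Then: (i) $X\,\mathcal{R}_{0,X}=\{0\}$; (ii) $\mathcal{R}_{0,X}$ is independent of $X$, i.e. $\mathcal{R}_{0,X}=\mathcal{R}_{0,Y}$ for any two symmetric solutions $X,Y$ of CGCARE($\Sigma$); (iii) the restriction $A_X|_{\mathcal{R}_{0,X}}$ is independent of $X$, i.e. $A_X|_{\mathcal{R}_{0,X}}=A_Y|_{\mathcal{R}_{0,Y}}$ for any two symmetric solutions $X,Y$ of CGCARE($\Sigma$).
   Context: Let $A\in\mathbb{R}^{n\times n}$, $B,S\in\mathbb{R}^{n\times m}$, $Q\in\mathbb{R}^{n\times n}$, $R\in\mathbb{R}^{m\times m}$, with the standing assumption $\Pi=\begin{bmatrix}Q&S\\S^\top&R\end{bmatrix}=\Pi^\top\ge 0$ ($R$ may be singular), and let $\Sigma=(A,B,\Pi)$. $M^\dagger$ denotes the Moore–Penrose pseudo-inverse. GCARE($\Sigma$) is the equation $XA+A^\top X-(S+XB)R^\dagger(S^\top+B^\top X)+Q=0$. CGCARE($\Sigma$) is GCARE($\Sigma$) together with the condition $\ker R\subseteq\ker(S+XB)$. $G=I_m-R^\dagger R$ is the orthogonal projector onto $\ker R$. For $X=X^\top$: $S_X=S+XB$, $K_X=R^\dagger S_X^\top$, $A_X=A-BK_X$. *)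

(* Defs.v *)
From HB Require Import structures.
From mathcomp Require Import all_boot all_order all_algebra.
From mathcomp Require Import reals.
Set Implicit Arguments.
Unset Strict Implicit.
Unset Printing Implicit Defensive.
Import Order.TTheory GRing.Theory Num.Theory.
Local Open Scope ring_scope.

(* Matrices act on the left on column vectors, so images and kernels are
   subspaces of 'cV and not the row spaces of mxalgebra. *)
Definition mxact (F : realType) (m n : nat) (M : 'M[F]_(m, n)) :
    'Hom('cV[F]_n, 'cV[F]_m) :=
  linfun (mulmx M).

Definition mxim (F : realType) (m n : nat) (M : 'M[F]_(m, n)) :
    {vspace 'cV[F]_m} :=
  limg (mxact M).

Definition mxker (F : realType) (m n : nat) (M : 'M[F]_(m, n)) :
    {vspace 'cV[F]_n} :=
  lker (mxact M).

Lemma mxactE (F : realType) (m n : nat) (M : 'M[F]_(m, n)) (v : 'cV[F]_n) :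
  mxact M v = M *m v.
Proof. by rewrite lfunE. Qed.

Lemma mem_mxker (F : realType) (m n : nat) (M : 'M[F]_(m, n)) (v : 'cV[F]_n) :
  (v \in mxker M) = (M *m v == 0).
Proof. by rewrite memv_ker mxactE. Qed.

Lemma mem_mxim (F : realType) (m n : nat) (M : 'M[F]_(m, n)) (w : 'cV[F]_m) :
  reflect (exists v : 'cV[F]_n, w = M *m v) (w \in mxim M).
Proof.
apply: (iffP memv_imgP) => [[v _ ->]|[v ->]].
  by exists v; rewrite mxactE.
by exists v; rewrite ?memvf ?mxactE.
Qed.

Definition psdmx (F : realType) (n : nat) (M : 'M[F]_n) : Prop :=
  M^T = M /\ forall v : 'cV[F]_n, 0 <= (v^T *m M *m v) 0 0.

Definition penrose (F : realType) (m n : nat)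
    (M : 'M[F]_(m, n)) (N : 'M[F]_(n, m)) : bool :=
  [&& M *m N *m M == M, N *m M *m N == N,
      (M *m N)^T == M *m N & (N *m M)^T == N *m M].

Lemma mulmx_tr_eq0 (F : realType) (m n : nat) (M : 'M[F]_(m, n)) :
  M *m M^T = 0 -> M = 0.
Proof.
move=> MM0; apply/matrixP => i j; rewrite mxE.
have /matrixP/(_ i i) := MM0; rewrite !mxE => /eqP.
rewrite psumr_eq0 => [/allP/(_ j (mem_index_enum j))|k _]; last first.
  by rewrite mxE -expr2 sqr_ge0.
by rewrite mxE mulf_eq0 orbb => /eqP.
Qed.

Lemma row_free_gram (F : realType) (m n : nat) (M : 'M[F]_(m, n)) :
  row_free M -> M *m M^T \in unitmx.
Proof.
move=> Mfree; rewrite -row_free_unit -kermx_eq0.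
have kM0 : kermx (M *m M^T) *m M = 0.
  apply: mulmx_tr_eq0; rewrite trmx_mul mulmxA.
  by rewrite -(mulmxA _ M) mulmx_ker mul0mx.
by apply/eqP/(row_free_inj Mfree); rewrite kM0 mul0mx.
Qed.

Lemma penrose_factor (F : realType) (m n r : nat) (C : 'M[F]_(m, r))
    (D : 'M[F]_(r, n)) :
  C^T *m C \in unitmx -> D *m D^T \in unitmx ->
  penrose (C *m D)
    (D^T *m invmx (D *m D^T) *m invmx (C^T *m C) *m C^T).
Proof.
move=> UC UD; set P := invmx (D *m D^T); set L := invmx (C^T *m C).
have PT : P^T = P by rewrite /P trmx_inv trmx_mul trmxK.
have LT : L^T = L by rewrite /L trmx_inv trmx_mul trmxK.
set N := D^T *m P *m L *m C^T.
have MN : C *m D *m N = C *m L *m C^T.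
  by rewrite /N !mulmxA -(mulmxA C D) -(mulmxA C) mulmxV // mulmx1.
have NM : N *m (C *m D) = D^T *m P *m D.
  rewrite /N !mulmxA -(mulmxA _ C^T C) -(mulmxA _ L).
  by rewrite mulVmx // mulmx1.
apply/and4P; split; apply/eqP.
- rewrite MN !mulmxA -(mulmxA _ C^T C) -(mulmxA _ L) mulVmx //.
  by rewrite mulmx1.
- rewrite NM /N !mulmxA -(mulmxA _ D D^T) -(mulmxA _ P (D *m D^T)).
  by rewrite mulVmx // mulmx1.
- by rewrite MN !trmx_mul trmxK LT mulmxA.
- by rewrite NM !trmx_mul trmxK PT mulmxA.
Qed.

Lemma penrose_exists (F : realType) (m n : nat) (M : 'M[F]_(m, n)) :
  exists N : 'M[F]_(n, m), penrose M N.
Proof.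
have UD := row_free_gram (row_base_free M).
have UC : (col_base M)^T *m col_base M \in unitmx.
  have := @row_free_gram F _ _ (col_base M)^T; rewrite trmxK; apply.
  by rewrite /row_free mxrank_tr; apply: col_base_full.
by have := penrose_factor UC UD; rewrite mulmx_base; eexists; eassumption.
Qed.

Lemma penrose_unique (F : realType) (m n : nat) (M : 'M[F]_(m, n))
    (N N' : 'M[F]_(n, m)) : penrose M N -> penrose M N' -> N = N'.
Proof.
case/and4P=> /eqP a1 /eqP a2 /eqP a3 /eqP a4.
case/and4P=> /eqP b1 /eqP b2 /eqP b3 /eqP b4.
have eMN : M *m N = M *m N'.
  by rewrite -a3 -{1}b1 -(mulmxA _ M N) trmx_mul a3 b3 mulmxA a1.
have eNM : N *m M = N' *m M.
  by rewrite -a4 -{1}b1 -mulmxA mulmxA trmx_mul b4 a4 -mulmxA (mulmxA M) a1.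
by rewrite -a2 eNM -mulmxA eMN mulmxA b2.
Qed.

(* Moore-Penrose pseudo-inverse. *)
Definition mpinv (F : realType) (m n : nat) (M : 'M[F]_(m, n)) : 'M[F]_(n, m) :=
  xchoose (penrose_exists M).

Lemma mpinvP (F : realType) (m n : nat) (M : 'M[F]_(m, n)) :
  penrose M (mpinv M).
Proof. exact: xchooseP. Qed.

Definition popov (F : realType) (n m : nat)
    (Q : 'M[F]_n) (S : 'M[F]_(n, m)) (R : 'M[F]_m) : 'M[F]_(n + m) :=
  block_mx Q S S^T R.

Definition GCARE (F : realType) (n m : nat) (A : 'M[F]_n) (B : 'M[F]_(n, m))
    (Q : 'M[F]_n) (S : 'M[F]_(n, m)) (R : 'M[F]_m) (X : 'M[F]_n) : Prop :=
  X *m A + A^T *m X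
    - (S + X *m B) *m mpinv R *m (S^T + B^T *m X) + Q = 0.

Definition CGCARE (F : realType) (n m : nat) (A : 'M[F]_n) (B : 'M[F]_(n, m))
    (Q : 'M[F]_n) (S : 'M[F]_(n, m)) (R : 'M[F]_m) (X : 'M[F]_n) : Prop :=
  GCARE A B Q S R X /\ (mxker R <= mxker (S + X *m B)%R)%VS.

Definition kerproj (F : realType) (m : nat) (R : 'M[F]_m) : 'M[F]_m :=
  1%:M - mpinv R *m R.

Definition gain (F : realType) (n m : nat) (B S : 'M[F]_(n, m)) (R : 'M[F]_m)
    (X : 'M[F]_n) : 'M[F]_(m, n) :=
  mpinv R *m (S + X *m B)^T.

Definition closed_loop (F : realType) (n m : nat) (A : 'M[F]_n)
    (B S : 'M[F]_(n, m)) (R : 'M[F]_m) (X : 'M[F]_n) : 'M[F]_n :=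
  A - B *m gain B S R X.

Definition reach0 (F : realType) (n m : nat) (A : 'M[F]_n)
    (B S : 'M[F]_(n, m)) (R : 'M[F]_m) (X : 'M[F]_n) : {vspace 'cV[F]_n} :=
  mxim (\mxrow_(j < n) (closed_loop A B S R X ^+ j *m B *m kerproj R)).

(* Main.v *)
Require Import Defs.
From mathcomp Require Import all_boot all_order all_algebra.
From mathcomp Require Import reals.
From mathcomp Require Import ring lra.
Set Implicit Arguments.
Unset Strict Implicit.
Unset Printing Implicit Defensive.
Import Order.TTheory GRing.Theory Num.Theory.
Local Open Scope ring_scope.

(** With [K] the gain of a solution [X] and [A_X = A - B K], the Riccati
    equation becomes the Lyapunov equation [X A_X + A_X^T X + M^T Pi M = 0],
    where [M = [1; -K]]. If [X W = 0] then [W^T M^T Pi M W = 0], so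
    [Pi >= 0] forces [M^T Pi M W = 0] and hence [X A_X W = 0]: the kernel of [X]
    is [A_X]-invariant. It contains the image of [B G], because both [S] and
    [S + X B] vanish on [ker R]; this is (i). On [ker X] the map [A_X]
    coincides with [A - B R^+ S^T], which does not involve [X], so
    [A_X^j B G = A_Y^j B G] by induction on [j]. *)

Lemma mulmx_col (F : realType) (m n p : nat) (M : 'M[F]_(m, n))
    (W : 'M[F]_(n, p)) (j : 'I_p) : M *m col j W = col j (M *m W).
Proof. by rewrite !colE mulmxA. Qed.

Lemma quad_col (F : realType) (n p : nat) (M : 'M[F]_n) (W : 'M[F]_(n, p))
    (j : 'I_p) :
  ((col j W)^T *m M *m col j W) 0 0 = (W^T *m M *m W) j j.
Proof.
rewrite tr_col -row_mul mulmx_col !mxE.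
by apply: eq_bigr => k _; rewrite !mxE.
Qed.

Lemma quad_ge0_lin_eq0 (F : realFieldType) (a b : F) :
  0 <= b -> (forall t, 0 <= t * a *+ 2 + t ^+ 2 * b) -> a = 0.
Proof.
move=> b_ge0 q; have b1 : 0 < 1 + b by lra.
(* The minimiser [- a / b] is undefined for [b = 0]; with denominator [1 + b] the form still takes
   the nonpositive value [- (a / (1 + b)) ^+ 2 * (2 + b)]. *)
have := q (- a / (1 + b)).
rewrite (_ : _ + _ = - ((a / (1 + b)) ^+ 2 * (2 + b))); last by field; lra.
rewrite oppr_ge0 pmulr_lle0; last by lra.
move=> s_le0; have : (a / (1 + b)) ^+ 2 == 0 by rewrite eq_le s_le0 sqr_ge0.
by rewrite sqrf_eq0 mulf_eq0 invr_eq0 (gt_eqF b1) orbF => /eqP.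
Qed.

(* The form at [v + t M v] is nonnegative for all [t], and its linear
   coefficient is [2 |M v|^2]. *)
Lemma psdmx_ker_vec (F : realType) (n : nat) (M : 'M[F]_n) (v : 'cV[F]_n) :
  psdmx M -> (v^T *m M *m v) 0 0 = 0 -> M *m v = 0.
Proof.
case=> MT M_ge0 v0; set w := M *m v.
have wE : w^T = v^T *m M by rewrite /w trmx_mul MT.
have a0 : (w^T *m w) 0 0 = 0.
  apply: quad_ge0_lin_eq0 (M_ge0 w) _ => t; have := M_ge0 (v + t *: w).
  have -> : (v + t *: w)^T = v^T + t *: w^T by rewrite linearD linearZ.
  rewrite !(mulmxDl, mulmxDr, =^~ scalemxAl, =^~ scalemxAr).
  rewrite -(mulmxA w^T M v) -/w -wE; move: v0; rewrite -wE.
  move: (w^T *m v) (w^T *m w) (w^T *m M *m w) => vv ww wMw vv0.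
  by rewrite !mxE vv0; congr (0 <= _); ring.
apply: trmx_inj; rewrite trmx0; apply: mulmx_tr_eq0; rewrite trmxK.
by apply/matrixP => i j; rewrite !ord1 a0 mxE.
Qed.

(** The diagonal entries of [W^T *m M *m W] are the values of the form at the columns of [W], so
    [psdmx_ker_vec] applies to each column. *)
Lemma psdmx_ker (F : realType) (n p : nat) (M : 'M[F]_n) (W : 'M[F]_(n, p)) :
  psdmx M -> W^T *m M *m W = 0 -> M *m W = 0.
Proof.
move=> Mpsd W0; apply/matrixP => i j.
have /matrixP/(_ i 0) : M *m col j W = 0.
  by apply: psdmx_ker_vec => //; rewrite quad_col W0 mxE.
by rewrite mulmx_col !mxE.
Qed.

Lemma psdmx_congr (F : realType) (n p : nat) (P : 'M[F]_n) (M : 'M[F]_(n, p)) :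
  psdmx P -> psdmx (M^T *m P *m M).
Proof.
case=> PT P_ge0; split=> [|v]; first by rewrite !trmx_mul trmxK PT mulmxA.
by have := P_ge0 (M *m v); rewrite trmx_mul !mulmxA.
Qed.

(** Transposing the Penrose equations of a symmetric [R] shows that [(mpinv R)^T] satisfies them
    too; uniqueness concludes. *)
Lemma mpinv_sym (F : realType) (m : nat) (R : 'M[F]_m) :
  R^T = R -> (mpinv R)^T = mpinv R.
Proof.
move=> RT; apply: (@penrose_unique _ _ _ R); last exact: mpinvP.
case/and4P: (mpinvP R) => /eqP e1 /eqP e2 /eqP e3 /eqP e4.
have RN : R *m (mpinv R)^T = mpinv R *m R by rewrite -e4 trmx_mul RT.
have NR : (mpinv R)^T *m R = R *m mpinv R by rewrite -e3 trmx_mul RT.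
apply/and4P; split; apply/eqP.
- by apply: trmx_inj; rewrite !trmx_mul trmxK RT mulmxA.
- by apply: trmx_inj; rewrite !trmx_mul !trmxK RT mulmxA.
- by rewrite RN e4.
- by rewrite NR e3.
Qed.

Lemma mul_kerproj (F : realType) (m : nat) (R : 'M[F]_m) : R *m kerproj R = 0.
Proof.
case/and4P: (mpinvP R) => /eqP e1 _ _ _.
by rewrite /kerproj mulmxBr mulmx1 mulmxA e1 subrr.
Qed.

(** Turns the kernel inclusion in [CGCARE] into a matrix identity, column by column. *)
Lemma mxker_sub_mul0 (F : realType) (m n p q : nat) (M : 'M[F]_(m, n))
    (N : 'M[F]_(p, n)) (W : 'M[F]_(n, q)) :
  (mxker M <= mxker N)%VS -> M *m W = 0 -> N *m W = 0.
Proof.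
move=> /subvP sub MW; apply/matrixP => i j.
have /sub : col j W \in mxker M.
  by rewrite mem_mxker mulmx_col MW; apply/eqP/matrixP => k l; rewrite !mxE.
by rewrite mem_mxker mulmx_col => /eqP/matrixP/(_ i 0); rewrite !mxE.
Qed.

Lemma expmxS_mul (F : realType) (n m p : nat) (C : 'M[F]_n) (B : 'M[F]_(n, m))
    (G : 'M[F]_(m, p)) (j : nat) :
  C ^+ j.+1 *m B *m G = C *m (C ^+ j *m B *m G).
Proof. by rewrite exprS !mulmxA. Qed.

Section Popov.

Variables (F : realType) (n m : nat) (A : 'M[F]_n) (B : 'M[F]_(n, m)).
Variables (Q : 'M[F]_n) (S : 'M[F]_(n, m)) (R : 'M[F]_m).
Hypothesis hPi : psdmx (popov Q S R).

Lemma popov_sym : R^T = R.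
Proof. by case: hPi => + _; rewrite tr_block_mx => /eq_block_mx[]. Qed.

(** With [G = kerproj R], the form of [Pi] on [[0; G]] is [G^T R G = 0]. Hence [Pi] annihilates
    [[0; G]], and the upper block of this product is [S G]. *)
Lemma popov_mul_kerproj : S *m kerproj R = 0.
Proof.
pose W : 'M[F]_(n + m, m) := col_mx 0 (kerproj R).
have : popov Q S R *m W = 0.
  apply: psdmx_ker => //.
  rewrite -mulmxA mul_block_col !mulmx0 !add0r mul_kerproj.
  by rewrite tr_col_mx mul_row_col trmx0 mul0mx mulmx0 addr0.
by rewrite mul_block_col !mulmx0 !add0r -(col_mx0 F n m m) => /eq_col_mx[].
Qed.

Variable X : 'M[F]_n.
Hypothesis XT : X^T = X.
Hypothesis hX : CGCARE A B Q S R X.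

Notation K := (gain B S R X).
Notation A_ := (closed_loop A B S R X).

Lemma CGCARE_mul_kerproj : X *m B *m kerproj R = 0.
Proof.
case: hX => _ /mxker_sub_mul0/(_ (mul_kerproj R)).
by rewrite mulmxDl popov_mul_kerproj add0r.
Qed.

Lemma CGCARE_lyapunov :
  X *m A_ + A_^T *m X
    + (col_mx 1%:M (- K))^T *m popov Q S R *m col_mx 1%:M (- K) = 0.
Proof.
case: hX => + _; rewrite /GCARE.
case/and4P: (mpinvP R) => _ /eqP e2 _ _.
have KT : K^T = (S + X *m B) *m mpinv R.
  by rewrite /gain trmx_mul trmxK mpinv_sym // popov_sym.
have SXT : S^T + B^T *m X = (S + X *m B)^T by rewrite linearD /= trmx_mul XT.
(* The middle factor collapses by [R^+ R R^+ = R^+]. *)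
have KRK : K^T *m R *m K = S *m K + X *m B *m K.
  rewrite -mulmxDl KT /gain -!mulmxA; congr (_ *m _).
  by rewrite !mulmxA e2.
(* Both sides are [(S + X B) R^+ (S + X B)^T], with [R^+] grouped to the right or to the left. *)
have KSX : S *m K + X *m B *m K = K^T *m S^T + K^T *m B^T *m X.
  by rewrite -(mulmxA K^T) -mulmxDr -mulmxDl SXT KT -mulmxA.
have AT : A_^T = A^T - K^T *m B^T.
  by rewrite /closed_loop linearB /= trmx_mul.
have NKT : (- K)^T = - K^T by rewrite linearN.
rewrite SXT -[_ *m mpinv R *m _]mulmxA -/(gain B S R X).
rewrite tr_col_mx mul_row_block mul_row_col trmx1 !mul1mx mulmx1 AT NKT.
rewrite /closed_loop; move: KRK KSX {KT AT NKT}; move: (gain B S R X) => k.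
rewrite !(mulmxDl, mulmxDr, mulNmx, mulmxN, mulmxA) => -> + E; rewrite -E.
(* With the products made opaque, the Lyapunov and Riccati expressions differ by
   [(a + b) - (c + d)], which [KSX] cancels entrywise. *)
move: (S *m k) (X *m B *m k) (k^T *m S^T) (k^T *m B^T *m X) => a b c d.
move: (X *m A) (A^T *m X) => e f /matrixP KSX.
by apply/matrixP => i j; have := KSX i j; rewrite !mxE; lra.
Qed.

Lemma ker_closed_loop_stable (p : nat) (W : 'M[F]_(n, p)) :
  X *m W = 0 -> X *m (A_ *m W) = 0.
Proof.
move=> XW; move: CGCARE_lyapunov (psdmx_congr (col_mx 1%:M (- K)) hPi).
move: (_ *m col_mx _ _) (closed_loop A B S R X) => P C L Ppsd.
have WX : W^T *m X = 0 by rewrite -XT -trmx_mul XW trmx0.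
have PW : P *m W = 0.
  (* Between [W^T] and [W], both terms of [L] containing [X] vanish, one by [XW] and the other by
     [WX]. *)
  apply: psdmx_ker => //; have /(congr1 (fun Z => W^T *m Z *m W)) := L.
  rewrite !(mulmxDl, mulmxDr) (mulmxA _ X) WX !mul0mx add0r.
  by rewrite -(mulmxA _ (_ *m X)) -(mulmxA _ X) XW !mulmx0 add0r mul0mx.
have /(congr1 (mulmx^~ W)) := L.
by rewrite !mulmxDl PW -(mulmxA _ X W) XW mulmx0 !addr0 mul0mx -mulmxA.
Qed.

Lemma CGCARE_reach_mul0 (j : nat) : X *m (A_ ^+ j *m B *m kerproj R) = 0.
Proof.
elim: j => [|j IHj]; first by rewrite expr0 mul1mx mulmxA CGCARE_mul_kerproj.
by rewrite expmxS_mul ker_closed_loop_stable.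
Qed.

Lemma CGCARE_reach0_mul0 (v : 'cV[F]_n) : v \in reach0 A B S R X -> X *m v = 0.
Proof.
case/mem_mxim => u ->; rewrite mulmxA mul_mxrow.
rewrite (_ : \mxrow_j _ = 0) ?mul0mx //.
by rewrite -mxrow0; apply: eq_mxrow => j; rewrite CGCARE_reach_mul0.
Qed.

End Popov.

(** By symmetry of [X], the gain depends on [X] only through [R^+ B^T X], which vanishes on [W]. *)
Lemma closed_loop_ker (F : realType) (n m p : nat) (A : 'M[F]_n)
    (B S : 'M[F]_(n, m)) (R : 'M[F]_m) (X : 'M[F]_n) (W : 'M[F]_(n, p)) :
  X^T = X -> X *m W = 0 ->
  closed_loop A B S R X *m W = (A - B *m (mpinv R *m S^T)) *m W.
Proof.
move=> XT XW; rewrite /closed_loop /gain.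
have -> : (S + X *m B)^T = S^T + B^T *m X by rewrite linearD /= trmx_mul XT.
rewrite !mulmxBl; congr (_ - _); rewrite -!mulmxA; congr (_ *m (_ *m _)).
by rewrite mulmxDl -mulmxA XW mulmx0 addr0.
Qed.

Lemma reach0_eq (F : realType) (n m : nat) (A : 'M[F]_n) (B : 'M[F]_(n, m))
    (Q : 'M[F]_n) (S : 'M[F]_(n, m)) (R : 'M[F]_m) (X Y : 'M[F]_n) :
  psdmx (popov Q S R) -> X^T = X -> CGCARE A B Q S R X ->
  Y^T = Y -> CGCARE A B Q S R Y -> reach0 A B S R X = reach0 A B S R Y.
Proof.
move=> hPi XT hX YT hY; rewrite /reach0; congr (mxim _).
apply: eq_mxrow => k; move: (nat_of_ord k) => {k} j.
have X0 := CGCARE_reach_mul0 hPi XT hX.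
have Y0 := CGCARE_reach_mul0 hPi YT hY.
have CX i := closed_loop_ker A B S R XT (X0 i).
have CY i := closed_loop_ker A B S R YT (Y0 i).
move: (closed_loop A B S R X) (closed_loop A B S R Y) CX CY => C D CX CY {X0 Y0}.
elim: j => [|j IHj]; first by rewrite !expr0.
(* [CX] and [CY] replace the leading factors [C] and [D] by the same matrix, free of [X] and [Y]. *)
by rewrite !expmxS_mul CX CY IHj.
Qed.

Theorem theorem3 (F : realType) (n m : nat) (A : 'M[F]_n) (B : 'M[F]_(n, m))
    (Q : 'M[F]_n) (S : 'M[F]_(n, m)) (R : 'M[F]_m)
    (hPi : psdmx (popov Q S R)) :
  [/\ (forall X : 'M[F]_n, X^T = X -> CGCARE A B Q S R X ->
         (mxact X @: reach0 A B S R X = 0)%VS),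
      (forall X Y : 'M[F]_n, X^T = X -> CGCARE A B Q S R X ->
         Y^T = Y -> CGCARE A B Q S R Y ->
         reach0 A B S R X = reach0 A B S R Y)
    & (forall X Y : 'M[F]_n, X^T = X -> CGCARE A B Q S R X ->
         Y^T = Y -> CGCARE A B Q S R Y ->
         reach0 A B S R X = reach0 A B S R Y /\
         (forall v : 'cV[F]_n, v \in reach0 A B S R X ->
            closed_loop A B S R X *m v = closed_loop A B S R Y *m v))].
Proof.
have RXY X Y := @reach0_eq F n m A B Q S R X Y hPi.
split=> [X XT hX|X Y|X Y XT hX YT hY]; last split; try exact: RXY.
  apply/eqP; rewrite -subv0; apply/subvP => _ /memv_imgP[v vR ->].
  by rewrite mxactE (CGCARE_reach0_mul0 hPi XT hX) ?memv0.
(* By (ii), [v] lies in both subspaces, so [X] and [Y] both annihilate it and the two closed loops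
   act on it as one matrix. *)
move=> v vR; have vRY := vR; rewrite (RXY X Y) // in vRY.
rewrite (closed_loop_ker A B S R XT (CGCARE_reach0_mul0 hPi XT hX vR)).
by rewrite (closed_loop_ker A B S R YT (CGCARE_reach0_mul0 hPi YT hY vRY)).
Qed.
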